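(* Let $E$ be a Banach space such that $(B_{E^{\ast}}, \omega^{\ast})$ is convex block compact and let $D$ be a weakly relatively compact subset of $E$ with $L_{D}(E^{\ast}, E) \neq \emptyset$. If $B$ is a bounded subset of $E$ such that every element of $L_D (E^{\ast}, E)$ attains its supremum on $B$, then $B$ is weakly relatively compact.
   Context: Banach spaces are real. $B_{E^\ast}$ is the closed unit ball of $E^\ast$ and $\omega^\ast=\sigma(E^\ast,E)$. For $D\subset E$: if $D \ne\emptyset$, $L_D(E^\ast,E) := \{x^\ast\in E^\ast : \sup_{d\in D} x^\ast(d) < 0\}$; if $D=\emptyset$, $L_\emptyset(E^\ast,E) := E^\ast\setminus\{0\}$. Given a sequence $(x_n)_{n\in\mathbb{N}}$ in a vector space, a sequence $(y_n)_{n\in\mathbb{N}}$ is a convex block subsequence of $(x_n)$ if there exist a sequence $(A_n)_{n\in\mathbb{N}}$ of pairwise disjoint finite subsets of $\mathbb{N}$ and a sequence $(\lambda_k)_{k\in\mathbb{N}}$ of real numbers $\lambda_k \ge 0$ such that $y_n = \sum_{k\in A_n}\lambda_k x_k$ and $\sum_{k\in A_n}\lambda_k = 1$ for each $n$. A subset $C$ of a topological vector space $(X,\tau)$ is convex block compact if every sequence of elements of $C$ admits a convex block subsequence which $\tau$-converges to an element of $C$. *)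

(* Defs.v *)
From HB Require Import structures.
From mathcomp Require Import all_boot all_order all_algebra finmap.
From mathcomp Require Import all_classical all_reals all_analysis.

Set Implicit Arguments.
Unset Strict Implicit.
Unset Printing Implicit Defensive.

Import Order.TTheory GRing.Theory Num.Theory.
Import numFieldNormedType.Exports.

Local Open Scope classical_set_scope.
Local Open Scope ring_scope.

Section Dual.
Context {R : realType} (E : normedModType R).

Definition dual_pred : {pred E -> R^o} :=
  mem [set f : E -> R^o | linear f /\ continuous f].

Lemma dual_submod_closed : submod_closed dual_pred.
Proof.
split.
  rewrite inE; split; last exact: cst_continuous.
  by move=> a x y /=; rewrite scaler0 addr0.
move=> a f g; rewrite !inE => -[lf cf] [lg cg]; split.
  move=> b x y; rewrite !fctE lf lg !scalerDr !scalerA (mulrC a b).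
  by rewrite addrACA.
move=> x; apply: continuousD; last exact: cg.
by apply: continuousZl_tmp; exact: cf.
Qed.

HB.instance Definition _ :=
  GRing.isSubmodClosed.Build R (E -> R^o) dual_pred dual_submod_closed.

Record dual : predArgType := Dual {
  dual_fun :> E -> R^o ;
  dual_funP : dual_fun \in dual_pred
}.

HB.instance Definition _ := [isSub for dual_fun].
HB.instance Definition _ := [Choice of dual by <:].
HB.instance Definition _ := [SubChoice_isSubLmodule of dual by <:].

Lemma dual_fun_linear (f : dual) : linear (f : E -> R^o).
Proof. by have := dual_funP f; rewrite inE => -[]. Qed.

Lemma dual_fun_continuous (f : dual) : continuous (f : E -> R^o).
Proof. by have := dual_funP f; rewrite inE => -[]. Qed.

HB.instance Definition _ (f : dual) :=
  GRing.isLinear.Build R E R^o *:%R (dual_fun f) (dual_fun_linear f).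

Definition dual_norm (f : dual) : R :=
  sup [set `|f x| | x in [set x : E | `|x| <= 1]].

Definition dual_unit_ball : set dual := [set f | dual_norm f <= 1].

(* E with its weak topology: the coarsest one making every f : dual continuous. *)
Definition weak_space : Type := E.

HB.instance Definition _ := GRing.Lmodule.copy weak_space E.
HB.instance Definition _ := Topological.copy weak_space
  (sup_topology (fun f : dual =>
    Topological.class (initial_topology (dual_fun f)))).

(* The dual with its weak-star topology: the coarsest one making every
   evaluation f |-> f x continuous. *)
Definition weak_star_dual : Type := dual.

HB.instance Definition _ := GRing.Lmodule.copy weak_star_dual dual.
HB.instance Definition _ := Topological.copy weak_star_dual
  (sup_topology (fun x : E =>
    Topological.class (initial_topology (fun f : dual => f x)))).

Lemma weak_star_eval_continuous (x : E) :
  continuous (fun f : weak_star_dual => (f : dual) x).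
Proof.
move=> f; have /cvg_sup/(_ x) fx : nbhs f --> f by exact: cvg_id.
apply: cvg_trans.
  exact/cvg_app/fx.
exact: (@initial_continuous _ _ (fun f : dual => f x)).
Qed.

Lemma weak_star_continuous (T : topologicalType) (h : T -> weak_star_dual) :
  (forall x, continuous (fun t => (h t : dual) x)) -> continuous h.
Proof.
move=> ch t; apply/cvg_sup => x.
have := @continuous_comp_initial _ _ _ (fun f : dual => f x) h.
by move=> /(_ (ch x) t).
Qed.

Lemma weak_star_cvg_eval (T : topologicalType) (h : T -> weak_star_dual)
    (t : T) (x : E) :
  h s @[s --> t] --> h t -> ((h s : dual) x : R^o) @[s --> t] --> (h t : dual) x.
Proof.
move=> ht; apply: (@continuous_cvg _ weak_star_dual R^o _ _ h
  (fun f : weak_star_dual => (f : dual) x)) => //.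
exact: weak_star_eval_continuous.
Qed.

Lemma weak_star_add_continuous :
  continuous (fun z : weak_star_dual * weak_star_dual => z.1 + z.2).
Proof.
apply: weak_star_continuous => x z; rewrite /continuous_at.
apply: (@cvgD _ R^o _ _ _ (fun t => (t.1 : dual) x) (fun t => (t.2 : dual) x)).
- by apply: (@weak_star_cvg_eval _ fst); exact: cvg_fst.
- by apply: (@weak_star_cvg_eval _ snd); exact: cvg_snd.
Qed.

Lemma weak_star_scale_continuous :
  continuous (fun z : R^o * weak_star_dual => z.1 *: z.2).
Proof.
apply: weak_star_continuous => x z; rewrite /continuous_at.
apply: (@cvgM _ _ _ _ (fun t => t.1) (fun t => (t.2 : dual) x)).
- exact: cvg_fst.
- by apply: (@weak_star_cvg_eval _ snd); exact: cvg_snd.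
Qed.

HB.instance Definition _ :=
  PreTopologicalNmodule_isTopologicalNmodule.Build weak_star_dual
    weak_star_add_continuous.
HB.instance Definition _ :=
  TopologicalNmodule_isTopologicalLmodule.Build R weak_star_dual
    weak_star_scale_continuous.

Definition weakly_relatively_compact (D : set E) :=
  @compact weak_space (@closure weak_space D).

(* The empty case is separate: ereal_sup set0 = -oo, so the general formula
   would also admit the zero functional there. *)
Definition L_ (D : set E) : set dual :=
  if D == set0 then [set f | f != 0]
  else [set f | (ereal_sup [set (f d)%:E | d in D] < 0)%E].

Definition attains_sup (f : dual) (B : set E) :=
  exists2 b, B b & (f b)%:E = ereal_sup [set (f x)%:E | x in B].

End Dual.

Arguments dual_unit_ball {R} E.

Definition convex_block_subsequence {R : realType} {X : lmodType R}
    (x y : nat -> X) :=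
  exists (A : nat -> {fset nat}) (lambda : nat -> R),
    [/\ forall m n, m != n -> [disjoint A m & A n]%fset,
        forall k, 0 <= lambda k,
        forall n, y n = \sum_(k <- A n) lambda k *: x k &
        forall n, \sum_(k <- A n) lambda k = 1].

Definition convex_block_compact {R : realType} {X : topologicalLmodType R}
    (C : set X) :=
  forall x : nat -> X, (forall n, C (x n)) ->
  exists2 y : nat -> X, convex_block_subsequence x y &
  exists2 l, C l & y @ \oo --> l.

(* Main.v *)
From HB Require Import structures.
Require Import Defs.
From mathcomp Require Import all_boot all_order all_algebra finmap.
From mathcomp Require Import all_classical all_reals all_analysis.
From mathcomp Require Import ring lra.
Import Order.TTheory GRing.Theory Num.Theory.
Import numFieldNormedType.Exports.
Local Open Scope classical_set_scope.
Local Open Scope ring_scope.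

(** Suppose that [B] is bounded but not weakly relatively compact. An ultrafilter
    without weak limit on the weak closure of [B] defines a linear form [phi] on
    the dual which is approximated by points of [B] but is not an evaluation
    ([noncompact_virtual_point]). As [E] is complete, [phi] is at positive distance
    from the evaluations, and Hahn-Banach gives some [theta > 0] such that, for
    every finite set of points, some functional of the unit ball vanishes on it
    while [phi] exceeds [theta] there ([helly_separation]). Alternating the two
    facts produces James' triangular array: [f n] in the unit ball and [x k] in [B]
    with [f n (x k) > theta] for [n <= k] and [f n (x k) = 0] for [k < n].

    Convex block compactness is applied to this array. A convex block subsequence
    of [f] has a weak-star limit, which is nonpositive at every [x k]; subtracting
    it leaves functionals [h j] which tend to [0] pointwise on [E] although
    [h j (x k) >= theta] for all large [k] ([james_null_sequence]).

    The contradiction comes from Simons' inequality ([simons_inequality]): if all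
    countable convex combinations of a sequence of functions attain their suprema
    over a set, then some combination has a supremum close to what the pointwise
    upper limits allow. It is used twice. On the weak closure of [D] every
    functional attains its maximum, by compactness, so some combinations of tails
    of [h] are at most [eps] on [D] ([tail_class_small]). Fix a small [e] with
    supremum at most [-2 eps] on [D] (a multiple of a point of [L_ D]). Adding [e]
    puts all these combinations [F] into [L_ D], so that they attain their suprema
    over [B], and the inequality on [B] yields a combination for which [F + e] is
    about as small as [e] on [B]. But [F (x k) >= theta - o(1)] for every
    combination, with [x k] in [B].

    Countable combinations are not handled through their coefficients: Simons'
    inequality only needs a decreasing sequence of classes of functionals, each
    stable under the weights [1/2, 1/4, 1/8, ...]. *)

(** * Dyadic series *)

Lemma dyadic_series_shift {R : realType} (u : nat -> R) (l : R) :
  series (fun i => 2^-1 ^+ i.+1 * u i) @ \oo --> l ->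
  series (fun i => 2^-1 ^+ i.+1 * u i.+1) @ \oo --> 2 * l - u 0%N.
Proof.
move=> ul.
have ul' : series (fun i => 2^-1 ^+ i.+1 * u i) (n + 1)%N @[n --> \oo] --> l.
  by rewrite (cvg_shiftn 1 (series (fun i => 2^-1 ^+ i.+1 * u i))).
have -> : series (fun i => 2^-1 ^+ i.+1 * u i.+1) =
    (fun n => 2 * series (fun i => 2^-1 ^+ i.+1 * u i) (n + 1)%N - u 0%N).
  apply/funext => n; rewrite /series /= addn1 [in RHS]big_nat_recl // mulrDr expr1.
  rewrite mulrA divff ?pnatr_eq0 // mul1r addrC addKr big_distrr /=.
  by apply: eq_bigr => i _; rewrite [in RHS]exprS !mulrA divff ?pnatr_eq0 // mul1r.
by apply: cvgB; [exact: cvgMl_tmp|exact: cvg_cst].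
Qed.

Lemma dyadic_seriesS {R : realType} (u : nat -> R) (a b : R) :
  series (fun i => 2^-1 ^+ i.+1 * u i) @ \oo --> a ->
  series (fun i => 2^-1 ^+ i.+1 * u i.+1) @ \oo --> b ->
  a = 2^-1 * u 0%N + 2^-1 * b.
Proof.
move=> /dyadic_series_shift ua /(cvg_unique (@Rhausdorff R) ua) <-.
by field.
Qed.

Lemma dyadic_series_cst {R : realType} (a : R) :
  series (fun i => 2^-1 ^+ i.+1 * a) @ \oo --> a.
Proof.
have := @cvg_geometric_series R (2^-1 * a) 2^-1.
have h : `|2^-1 : R| < 1 by rewrite ger0_norm; lra.
move=> /(_ h); have -> : 2^-1 * a / (1 - 2^-1) = a by field.
rewrite (_ : geometric _ _ = fun i => 2^-1 ^+ i.+1 * a) //.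
by apply/funext => i /=; rewrite exprS mulrAC.
Qed.

Lemma dyadic_series_le {R : realType} (u : nat -> R) (a l : R) :
  (forall i, u i <= a) ->
  series (fun i => 2^-1 ^+ i.+1 * u i) @ \oo --> l -> l <= a.
Proof.
move=> ua ul.
apply: (ler_cvg_to ul (dyadic_series_cst a)); apply: nearW => n; apply: ler_sum => i _.
by rewrite ler_wpM2l // exprn_ge0 //; lra.
Qed.

Lemma dyadic_series_ge {R : realType} (u : nat -> R) (a l : R) :
  (forall i, a <= u i) ->
  series (fun i => 2^-1 ^+ i.+1 * u i) @ \oo --> l -> a <= l.
Proof.
move=> ua ul.
apply: (ler_cvg_to (dyadic_series_cst a) ul); apply: nearW => n; apply: ler_sum => i _.
by rewrite ler_wpM2l // exprn_ge0 //; lra.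
Qed.

(** A lower bound [b] valid for the first [n] terms only is still almost a lower
    bound of the sum, since the remaining terms have total weight [2 ^- n]. *)
Lemma dyadic_series_ge_head {R : realType} (n : nat) (u : nat -> R) (b c l : R) :
  (forall i, (i < n)%N -> b <= u i) -> (forall i, - c <= u i) ->
  series (fun i => 2^-1 ^+ i.+1 * u i) @ \oo --> l ->
  (1 - 2^-1 ^+ n) * b - 2^-1 ^+ n * c <= l.
Proof.
elim: n u l => [|n IH] u l ub uc ul.
  by rewrite expr0 subrr mul0r sub0r mul1r; exact: dyadic_series_ge uc ul.
have := IH (fun i => u i.+1) _ _ _ (dyadic_series_shift _ _ ul).
move=> /(_ (fun i ilt => ub i.+1 ilt) (fun i => uc i.+1)).
by have := ub 0%N isT; rewrite exprS; move: (2^-1 ^+ n) => e; lra.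
Qed.

Lemma dyadic_series_is_cvg {R : realType} (u : nat -> R) (M : R) :
  (forall i, `|u i| <= M) -> cvg (series (fun i => 2^-1 ^+ i.+1 * u i) @ \oo).
Proof.
move=> uM; have h2 i : 0 <= 2^-1 ^+ i :> R by apply: exprn_ge0; lra.
apply: normed_cvg.
apply: (@series_le_cvg _ _ (fun i => 2^-1 ^+ i.+1 * M)) => [i|i|i|].
- exact: normr_ge0.
- by rewrite mulr_ge0 // (le_trans _ (uM i)).
- by rewrite /= normrM ger0_norm // ler_wpM2l.
by apply/cvg_ex; exists M; exact: dyadic_series_cst.
Qed.

(** * Simons' inequality *)

Lemma near_minimizer {R : realType} {V : Type} (C : set V) (q : V -> R)
    (b d : R) :
  C !=set0 -> 0 < d -> (forall g, C g -> b <= q g) ->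
  exists2 g, C g & forall g', C g' -> q g <= q g' + d.
Proof.
move=> [g0 Cg0] d0 bq.
have hi : has_inf [set q g | g in C].
  by split; [exists (q g0), g0 | exists b => _ [g Cg <-]; exact: bq].
have [_ [g Cg <-] lt] := inf_adherent d0 hi.
exists g => // g' Cg'; apply: (le_trans (ltW lt)); rewrite lerD2r.
by apply: ge_inf; [exact: hi.2|exists g'].
Qed.

(** Write [p f] for the supremum of [f] over [X]. Choose [g n] in [C n] so that
    [p (s n + 2^-n g n)] is minimal up to an error [d n], where [s n] is the sum of
    the [2^-(i+1) g i] for [i < n]. The full sum is [s n + 2^-n t n], where [t n] is
    the dyadic combination of [g n, g n.+1, ...] and so is itself a competitor in
    the choice of [g n]. At a point [y] where the full sum attains its supremum this
    gives [g n y <= t n y] up to a small error; as [t n] is the mean of [g n] and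
    [t n.+1], the values [t n y] are almost nondecreasing in [n]. They start at the
    supremum of the full sum, and they are asymptotically at most [c]. *)
Lemma simons_inequality {R : realType} {V T : Type} (ev : V -> T -> R)
    (X : set T) (C : nat -> set V) (c eps : R) :
  0 < eps ->
  (forall n, C n !=set0) ->
  (forall n, C n.+1 `<=` C n) ->
  (forall n g, (forall i, C n (g i)) -> exists2 G, C n G &
    forall x, X x ->
      series (fun i => 2^-1 ^+ i.+1 * ev (g i) x) @ \oo --> ev G x) ->
  (forall G, C 0%N G -> exists2 y, X y & forall x, X x -> ev G x <= ev G y) ->
  (forall x eta, X x -> 0 < eta ->
    exists n, forall g, C n g -> ev g x <= c + eta) ->
  exists2 G, C 0%N G & forall x, X x -> ev G x <= c + eps.
Proof.
move=> eps0 Cne Cdec Cdy Cmax Clim; apply: contrapT => noG.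
pose p (f : T -> R) := sup [set f x | x in X].
have C0 n : C n `<=` C 0%N.
  by elim: n => // n IH g /Cdec /IH.
have pmax G : C 0%N G -> exists2 y, X y & p (ev G) = ev G y.
  move=> /Cmax[y Xy hy]; exists y => //; apply/eqP; rewrite eq_le; apply/andP.
  split; first by apply: ge_sup; [exists (ev G y), y | move=> _ [x Xx <-]; exact: hy].
  apply: ub_le_sup; last by exists y.
  by exists (ev G y) => _ [x Xx <-]; exact: hy.
have pub G x : C 0%N G -> X x -> ev G x <= p (ev G).
  move=> /Cmax[y Xy hy] Xx; apply: ub_le_sup; last by exists x.
  by exists (ev G y) => _ [z Xz <-]; exact: hy.
have plb G : C 0%N G -> c + eps <= p (ev G).
  move=> CG; rewrite leNgt; apply/negP => lt; apply: noG; exists G => // x Xx.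
  exact: le_trans (pub _ _ CG Xx) (ltW lt).
have peq f1 f2 : (forall x, X x -> f1 x = f2 x) -> p f1 = p f2.
  by move=> h; rewrite /p; congr sup; apply: eq_imagel => x /h.
pose comb n (s : T -> R) g x := s x + 2^-1 ^+ n * ev g x.
(* The induction carries only the partial sum [s]: what has to be remembered of
   the earlier choices is that completing [s] by an element of [C n] stays in
   [C 0], where suprema are attained and bounded below. *)
pose Inv n s := forall g, C n g ->
  exists2 G, C 0%N G & forall x, X x -> ev G x = comb n s g x.
(* The error in [g n y <= t n y] is [2 ^+ n * d n = eps / 4 * 2^-n], so that the
   errors add up to at most [eps / 2]. *)
pose d n := eps / 4 * 2^-1 ^+ n * 2^-1 ^+ n : R.
have h20 n : 0 < 2^-1 ^+ n :> R by apply: exprn_gt0; lra.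
have d0 n : 0 < d n by rewrite /d !mulr_gt0 // ?invr_gt0 ?ltr0n.
have /choice[pk pkP] (ns : nat * (T -> R)) : exists g0, Inv ns.1 ns.2 ->
    C ns.1 g0 /\ forall g, C ns.1 g ->
      p (comb ns.1 ns.2 g0) <= p (comb ns.1 ns.2 g) + d ns.1.
  case: ns => n s /=.
  have [I|nI] := pselect (Inv n s); last by have [g _] := Cne n; exists g.
  have [|g Cg hg] := @near_minimizer _ _ (C n) (fun g => p (comb n s g))
      (c + eps) (d n) (Cne n) (d0 n); last by exists g.
  by move=> g /I[G CG /peq <-]; exact: plb.
pose s := nat_rect (fun _ => T -> R) (fun=> 0)
  (fun n s => comb n.+1 s (pk (n, s))).
pose g n := pk (n, s n).
have sS n : s n.+1 = comb n.+1 (s n) (g n) by [].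
have IP n : Inv n (s n).
  elim: n => [|n IH] h Ch.
    by exists h => // x _; rewrite /comb /= expr0 mul1r add0r.
  have [gC _] := pkP (n, s n) IH.
  have [|H CH HE] := Cdy n (fun i => if i is 0%N then g n else h).
    by case=> [|i]; [exact: gC|exact: Cdec].
  have [G CG GE] := IH _ CH; exists G => // x Xx.
  rewrite GE // sS /comb.
  have -> : ev H x = 2^-1 * ev (g n) x + 2^-1 * ev h x.
    apply: (@dyadic_seriesS _ (fun i => ev (if i is 0%N then g n else h) x)).
      exact: HE.
    exact: dyadic_series_cst.
  by rewrite mulrDr !mulrA -!exprSr addrA.
have gC n : C n (g n) by have [] := pkP (n, s n) (IP n).
have gmin n h : C n h -> p (comb n (s n) (g n)) <= p (comb n (s n) h) + d n.
  by have [_] := pkP (n, s n) (IP n); apply.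
have Cadd n i : C (n + i)%N `<=` C n.
  by elim: i => [|i IH]; rewrite ?addn0 // addnS => h /Cdec /IH.
have /choice[t tP] n : exists G, C n G /\ forall x, X x ->
    series (fun i => 2^-1 ^+ i.+1 * ev (g (n + i)%N) x) @ \oo --> ev G x.
  have [|G CG GE] := Cdy n (fun i => g (n + i)%N); last by exists G.
  by move=> i; apply: Cadd (gC _).
have tS n x : X x -> ev (t n) x = 2^-1 * ev (g n) x + 2^-1 * ev (t n.+1) x.
  move=> Xx; have [_ /(_ x Xx) h1] := tP n; have [_ /(_ x Xx) h2] := tP n.+1.
  rewrite [in RHS](_ : ev (g n) x = ev (g (n + 0)%N) x); last by rewrite addn0.
  apply: (@dyadic_seriesS _ (fun i => ev (g (n + i)%N) x)) => //.
  by under eq_fun do rewrite addnS -addSn.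
have st n x : X x -> comb n (s n) (t n) x = ev (t 0%N) x.
  move=> Xx; elim: n => [|n <-]; first by rewrite /comb /= expr0 mul1r add0r.
  by rewrite sS /comb (tS n) // mulrDr !mulrA -!exprSr addrA.
have [y Xy ymax] := pmax _ (tP 0%N).1.
have tg n : ev (g n) y - eps / 4 * 2^-1 ^+ n <= ev (t n) y.
  have [G CG GE] := IP n _ (gC n).
  have h1 : comb n (s n) (g n) y <= comb n (s n) (t n) y + d n.
    rewrite -GE // (le_trans (pub _ _ CG Xy)) // (peq _ _ GE) st // -ymax.
    rewrite -(peq _ _ (st n)); apply: gmin; exact: (tP n).1.
  rewrite -(ler_pM2l (h20 n)) mulrBr lerBlDr; move: h1; rewrite /comb -addrA lerD2l.
  by rewrite /d; congr (_ <= _ + _); ring.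
have tlow n : ev (t 0%N) y - eps / 2 * (1 - 2^-1 ^+ n) <= ev (t n) y.
  elim: n => [|n IH]; first by rewrite expr0 subrr mulr0 subr0.
  have := tg n; have := tS n y Xy; rewrite exprS; move: IH (h20 n).
  move: (2^-1 ^+ n) => e IH e0 tSn h; nra.
have [|n hn] := Clim y (eps / 2) Xy; first lra.
have := hn _ (tP n).1; have := tlow n; have := plb _ (tP 0%N).1; rewrite ymax.
have := h20 n; move: (2^-1 ^+ n) => e; nra.
Qed.

(** * The Hahn-Banach theorem *)

Definition sublinear {R : realType} {V : lmodType R} (p : V -> R) :=
  (forall x y, p (x + y) <= p x + p y) /\
  (forall t x, 0 < t -> p (t *: x) <= t * p x).

Lemma sublinear0 {R : realType} {V : lmodType R} (p : V -> R) :
  sublinear p -> p 0 = 0.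
Proof.
move=> [_ hp].
have h2 : (0 : R) < 2 by lra.
have h12 : (0 : R) < 2^-1 by lra.
have := hp 2 0 h2; have := hp 2^-1 0 h12; rewrite !scaler0; lra.
Qed.

Lemma sublinear_ge {R : realType} {V : lmodType R} (p : V -> R) x :
  sublinear p -> - p (- x) <= p x.
Proof.
by move=> sp; rewrite -subr_ge0 opprK -(sublinear0 _ sp) -{1}(subrr x); exact: sp.1.
Qed.

Lemma linear_form0N {R : realType} {V : lmodType R} (f : V -> R^o) :
  linear f -> f 0 = 0 /\ forall x, f (- x) = - f x.
Proof.
move=> lf; have f0 : f 0 = 0.
  by have := lf (-1) 0 0; rewrite scaler0 !addr0 scaleN1r addNr.
by split=> // x; have := lf (-1) x 0; rewrite !scaleN1r !addr0 f0 addr0.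
Qed.

Section ConeLowering.
Context {R : realType} {V : lmodType R} (p : V -> R) (K : set (V * R)).
Context (sp : sublinear p) (K0 : K (0, 0))
  (KD : forall k l, K k -> K l -> K (k.1 + l.1, k.2 + l.2))
  (KZ : forall t k, 0 < t -> K k -> K (t *: k.1, t * k.2))
  (Kp : forall k, K k -> k.2 <= p k.1).

(** The largest sublinear function below [p] whose value at [- k.1] is at most
    [- k.2] for all [k] in the cone [K]; any linear form below it is below [p] and
    above [k.2] at [k.1]. *)
Definition lowering x := inf [set p (x + k.1) - k.2 | k in K].

Lemma lowering_le x k : K k -> lowering x <= p (x + k.1) - k.2.
Proof.
move=> Kk; apply: ge_inf; last by exists k.
exists (- p (- x)) => _ [l Kl <-].
have := Kp _ Kl; have := sp.1 (- x) (x + l.1); rewrite addKr; lra.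
Qed.

Lemma le_lowering x a :
  (forall k, K k -> a <= p (x + k.1) - k.2) -> a <= lowering x.
Proof.
move=> h; apply: lb_le_inf; first by exists (p (x + 0) - 0), (0, 0).
by move=> _ [k Kk <-]; exact: h.
Qed.

Lemma lowering_le_self x : lowering x <= p x.
Proof. by have := lowering_le x _ K0; rewrite addr0 subr0. Qed.

Lemma lowering_cone k : K k -> lowering (- k.1) <= - k.2.
Proof.
by move=> Kk; have := lowering_le (- k.1) _ Kk; rewrite addNr sublinear0 // sub0r.
Qed.

Lemma lowering_sublinear : sublinear lowering.
Proof.
split=> [x y|t x t0].
  rewrite -lerBlDr; apply: le_lowering => k Kk; rewrite lerBlDr -lerBlDl.
  apply: le_lowering => l Kl; rewrite lerBlDl.
  apply: (le_trans (lowering_le _ _ (KD _ _ Kk Kl))) => /=.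
  by have := sp.1 (x + k.1) (y + l.1); rewrite addrACA; lra.
rewrite -ler_pdivrMl //; apply: le_lowering => k Kk; rewrite ler_pdivrMl //.
apply: (le_trans (lowering_le _ _ (KZ _ _ t0 Kk))) => /=.
by rewrite -scalerDr mulrBr lerD2r; exact: sp.2.
Qed.

End ConeLowering.

(** Lowering [q] along the ray through [(y, q y)] cannot change [q], by minimality;
    this forces [q (- y) <= - q y], and an odd sublinear function is linear. *)
Lemma minimal_sublinear_linear {R : realType} {V : lmodType R} (q : V -> R) :
  sublinear q ->
  (forall q', sublinear q' -> (forall x, q' x <= q x) -> forall x, q x <= q' x) ->
  linear (q : V -> R^o).
Proof.
move=> sq qmin.
have qZ t x : 0 < t -> q (t *: x) = t * q x.
  move=> t0; apply/eqP; rewrite eq_le sq.2 //= -ler_pdivlMl //.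
  have -> : q x = q (t^-1 *: (t *: x)) by rewrite scalerA mulVf ?scale1r // gt_eqF.
  by apply: sq.2; rewrite invr_gt0.
have q0 := sublinear0 q sq.
have qN y : q (- y) = - q y.
  apply/eqP; rewrite eq_le; apply/andP; split; last first.
    by have := sublinear_ge q y sq; lra.
  pose K := [set k | exists2 t, 0 <= t & k = (t *: y, t * q y)].
  have Kq k : K k -> k.2 <= q k.1.
    move=> [t]; rewrite le_eqVlt => /predU1P[<- ->|t0 ->] /=; last by rewrite qZ.
    by rewrite scale0r q0 mul0r.
  have K0 : K (0, 0) by exists 0 => //; rewrite scale0r mul0r.
  have K1 : K (y, q y) by exists 1 => //; rewrite scale1r mul1r.
  apply: le_trans (lowering_cone q K sq Kq _ K1).
  apply: qmin => [|x]; last exact: lowering_le_self.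
  apply: lowering_sublinear => //.
    move=> _ _ [t t0 ->] [s s0 ->]; exists (t + s); first exact: addr_ge0.
    by rewrite /= scalerDl mulrDl.
  move=> t _ t0 [s s0 ->]; exists (t * s); first by rewrite mulr_ge0 // ltW.
  by rewrite /= scalerA mulrA.
have qD x y : q (x + y) = q x + q y.
  apply/eqP; rewrite eq_le sq.1 /=.
  by have := sq.1 (x + y) (- y); rewrite addrK qN; lra.
move=> t x y; rewrite qD; congr (_ + _).
have [t0|t0|->] := ltgtP t 0; last by rewrite !scale0r q0.
  by rewrite -[t]opprK scaleNr qN qZ ?oppr_gt0 // [RHS]scaleNr.
by rewrite qZ.
Qed.

(** By Zorn's lemma below [p] there is a minimal sublinear function; the pointwise
    infimum of a chain of sublinear functions is sublinear, and it is finite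
    because each of them is bounded below by [- p (- x)]. *)
Lemma linear_minorant {R : realType} {V : lmodType R} (p : V -> R) :
  sublinear p -> exists2 f : V -> R^o, linear f & forall x, f x <= p x.
Proof.
move=> sp.
pose T := {q : V -> R | sublinear q /\ forall x, q x <= p x}.
pose le_T (q1 q2 : T) := `[< forall x, sval q2 x <= sval q1 x >].
have p_in : sublinear p /\ forall x, p x <= p x by [].
have [|||[q [sq qp]] qmax] := @ZL_preorder T (exist _ p p_in) le_T.
- by move=> q; apply/asboolP.
- move=> q1 q2 q3 /asboolP h1 /asboolP h2; apply/asboolP => x.
  exact: le_trans (h2 x) (h1 x).
- move=> A totA; have [A0|/set0P[a Aa]] := eqVneq A set0.
    by exists (exist _ p p_in); rewrite A0.
  pose m x := inf [set sval q x | q in A].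
  have m_le q x : A q -> m x <= sval q x.
    move=> Aq; apply: ge_inf; last by exists q.
    exists (- p (- x)) => _ [r _ <-].
    by have := sublinear_ge _ x (svalP r).1; have := (svalP r).2 (- x); lra.
  have m_ge b x : (forall q, A q -> b <= sval q x) -> b <= m x.
    move=> h; apply: lb_le_inf; first by exists (sval a x), a.
    by move=> _ [q Aq <-]; exact: h.
  have sm : sublinear m /\ forall x, m x <= p x.
    split=> [|x]; last exact: le_trans (m_le a x Aa) ((svalP a).2 x).
    split=> [x y|t x t0].
      rewrite -lerBlDr; apply: (m_ge) => q1 Aq1; rewrite lerBlDr -lerBlDl.
      apply: (m_ge) => q2 Aq2; rewrite lerBlDl.
      have [/asboolP h|/asboolP h] := totA _ _ Aq1 Aq2.
        have := m_le q2 (x + y) Aq2; have := (svalP q2).1.1 x y; have := h x; lra.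
      have := m_le q1 (x + y) Aq1; have := (svalP q1).1.1 x y; have := h y; lra.
    rewrite -ler_pdivrMl //; apply: (m_ge) => q Aq; rewrite ler_pdivrMl //.
    exact: le_trans (m_le q _ Aq) ((svalP q).1.2 _ _ t0).
  by exists (exist _ m sm) => q Aq; apply/asboolP => x; exact: m_le.
exists q => //; apply: minimal_sublinear_linear => // q' sq' q'q.
have q'p : sublinear q' /\ forall x, q' x <= p x.
  by split=> // x; exact: le_trans (q'q x) (qp x).
have /(_ (introT (asboolP _) q'q))/asboolP := qmax (exist _ q' q'p).
exact.
Qed.

(** A form of Hahn-Banach that covers both extension from a subspace (take for [K]
    the graph of the form) and norming functionals (take for [K] a ray). *)
Lemma mazur_orlicz {R : realType} {V : lmodType R} (p : V -> R) (K : set (V * R)) :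
  sublinear p -> K (0, 0) ->
  (forall k l, K k -> K l -> K (k.1 + l.1, k.2 + l.2)) ->
  (forall t k, 0 < t -> K k -> K (t *: k.1, t * k.2)) ->
  (forall k, K k -> k.2 <= p k.1) ->
  exists f : V -> R^o, [/\ linear f, forall x, f x <= p x &
    forall k, K k -> k.2 <= f k.1].
Proof.
move=> sp K0 KD KZ Kp.
have [f lf fp] := linear_minorant _ (lowering_sublinear p K sp K0 KD KZ Kp).
exists f; split=> // [x|k Kk].
  exact: le_trans (fp x) (lowering_le_self p K sp K0 Kp x).
rewrite -lerN2 -(linear_form0N _ lf).2; exact: le_trans (fp _) (lowering_cone p K sp Kp _ Kk).
Qed.

(** * The dual norm and separation from finite-dimensional subspaces *)

Section DualNorm.
Context {R : realType} {E : normedModType R}.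
Implicit Types f g : dual E.

Lemma dual_of_bounded (h : E -> R) (M : R) :
  linear (h : E -> R^o) -> (forall x, `|h x| <= M * `|x|) ->
  exists f : dual E, forall x, f x = h x.
Proof.
move=> lh hM.
pose H := GRing.isLinear.Build R E R^o *:%R h lh.
pose h' : {linear E -> R^o} := HB.pack (h : E -> R^o) H.
have ch : continuous (h : E -> R^o).
  apply: (@bounded_linear_continuous R E R^o h'); apply/linear_boundedP.
  apply: filterS (nbhs_pinfty_ge (num_real M)) => r Mr x.
  by apply: le_trans (hM x) _; rewrite ler_wpM2r.
have hP : (h : E -> R^o) \in @dual_pred R E by rewrite inE.
by exists (Dual hP).
Qed.

Lemma dual_has_sup f : has_sup [set `|f x| | x in [set x : E | `|x| <= 1]].
Proof.
split; first by exists `|f 0|, 0 => //=; rewrite normr0.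
have := @continuous_linear_bounded R E R^o 0 (dual_fun f : {linear E -> R^o})
  (@dual_fun_continuous _ _ f 0).
move=> /linear_boundedP/pinfty_ex_gt0[r r0 fr]; exists r => _ [x /= x1 <-].
by apply: le_trans (fr x) _; rewrite ler_piMr // ltW.
Qed.

Lemma dual_norm_ge0 f : 0 <= dual_norm f.
Proof.
by apply: ub_le_sup (dual_has_sup f).2 _ _; exists 0 => /=; rewrite ?linear0 normr0.
Qed.

Lemma dual_norm_eval f x : `|f x| <= dual_norm f * `|x|.
Proof.
have [->|x0] := eqVneq x 0; first by rewrite linear0 !normr0 mulr0.
have nx : 0 < `|x| by rewrite normr_gt0.
rewrite -ler_pdivrMr // -[X in _ / X]normr_id -normfV mulrC -normrM.
apply: ub_le_sup (dual_has_sup f).2 _ _; exists (`|x|^-1 *: x) => /=.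
  by rewrite normrZ normfV normr_id mulVf // gt_eqF.
by rewrite linearZ.
Qed.

Lemma dual_norm_le f (M : R) : 0 <= M ->
  (forall x, `|f x| <= M * `|x|) -> dual_norm f <= M.
Proof.
move=> M0 fM; apply: ge_sup; first exact: (dual_has_sup f).1.
by move=> _ [x /= x1 <-]; apply: le_trans (fM x) _; rewrite ler_piMr.
Qed.

Lemma dual_norm_sublinear : sublinear (@dual_norm R E).
Proof.
split=> [f g|t f t0].
  apply: dual_norm_le => [|x]; first by rewrite addr_ge0 // dual_norm_ge0.
  rewrite mulrDl; apply: le_trans (ler_normD _ _) _.
  by apply: lerD; exact: dual_norm_eval.
apply: dual_norm_le => [|x]; first by rewrite mulr_ge0 ?dual_norm_ge0 // ltW.
rewrite -mulrA; change (`|t * f x| <= t * (dual_norm f * `|x|)).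
by rewrite normrM gtr0_norm // ler_pM2l // dual_norm_eval.
Qed.

Lemma dual_normN f : dual_norm (- f) = dual_norm f.
Proof.
have h g : dual_norm (- g) <= dual_norm g.
  apply: dual_norm_le => [|x]; first exact: dual_norm_ge0.
  by change (`|- g x| <= dual_norm g * `|x|); rewrite normrN dual_norm_eval.
by apply/eqP; rewrite eq_le h /= -{1}[f]opprK h.
Qed.

Lemma norming_functional (x0 : E) :
  exists2 f : dual E, dual_norm f <= 1 & f x0 = `|x0|.
Proof.
pose K := [set k : E * R | exists2 t, 0 <= t & k = (t *: x0, t * `|x0|)].
have [|||||h [lh hn hK]] := @mazur_orlicz R E (fun x => `|x|) K.
- split=> [x y|t x t0]; first exact: ler_normD.
  by rewrite normrZ gtr0_norm.
- by exists 0 => //; rewrite scale0r mul0r.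
- move=> _ _ [t t0 ->] [s s0 ->]; exists (t + s); first exact: addr_ge0.
  by rewrite /= scalerDl mulrDl.
- move=> t _ t0 [s s0 ->]; exists (t * s); first by rewrite mulr_ge0 // ltW.
  by rewrite /= scalerA mulrA.
- by move=> _ [t t0 ->] /=; rewrite normrZ ger0_norm.
have [_ hN] := linear_form0N _ lh.
have hle x : `|h x| <= 1 * `|x|.
  by rewrite mul1r ler_norml hn andbT lerNl -hN -normrN hn.
have [f fh] := dual_of_bounded _ _ lh hle.
exists f; first by apply: dual_norm_le => // x; rewrite fh.
have x0K : K (x0, `|x0|) by exists 1 => //; rewrite scale1r mul1r.
by apply/eqP; rewrite eq_le fh hn /=; exact: hK x0K.
Qed.

(** Induction on [xs]: if some [v] vanishes on the tail but not at the head [x],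
    subtracting a multiple of the evaluation at [x] from [L] makes it vanish at
    [v], hence on the whole common kernel of the tail. *)
Lemma functional_of_common_kernel (xs : seq E) (L : dual E -> R) :
  linear (L : dual E -> R^o) ->
  (forall f, (forall x, x \in xs -> f x = 0) -> L f = 0) ->
  exists y : E, forall f, L f = f y.
Proof.
elim: xs L => [|x xs IH] L lL hL.
  by exists 0 => f; rewrite hL // linear0.
have [[v [vxs vx]]|nv] := pselect (exists v : dual E,
    (forall z, z \in xs -> v z = 0) /\ v x != 0); last first.
  apply: IH => // f fxs; apply: hL => z; rewrite inE => /predU1P[->|/fxs //].
  by apply: contrapT => fx; apply: nv; exists f; split=> //; exact/eqP.
pose L' f := L f - f x * (L v / v x).
have [||y yE] := IH L'.
- move=> a f g; rewrite /L' lL.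
  change (a * L f + L g - (a * f x + g x) * (L v / v x) =
    a * (L f - f x * (L v / v x)) + (L g - g x * (L v / v x))).
  by ring.
- move=> f fxs; rewrite /L'.
  have : L ((- (f x / v x)) *: v + f) = 0.
    apply: hL => z; rewrite inE => zxs.
    change (- (f x / v x) * v z + f z = 0).
    case/predU1P: zxs => [->|zxs]; last by rewrite (vxs z) // (fxs z) // mulr0 addr0.
    by field.
  rewrite lL; change (- (f x / v x) * L v + L f = 0 -> L f - f x * (L v / v x) = 0).
  by move=> <-; field.
exists (y + (L v / v x) *: x) => f.
rewrite linearD linearZ /= -yE /L'.
by change (L f = L f - f x * (L v / v x) + (L v / v x) * f x); ring.
Qed.

End DualNorm.

(** The bound on the annihilator of [xs] extends, by Hahn-Banach, to a form [psi]
    with norm at most [theta] that agrees with [phi] on that annihilator, and then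
    [phi - psi] is an evaluation. *)
Lemma functional_near_evaluation {R : realType} {E : normedModType R}
    (phi : dual E -> R) (theta : R) (xs : seq E) :
  linear (phi : dual E -> R^o) -> 0 < theta ->
  (forall f, dual_norm f <= 1 -> (forall x, x \in xs -> f x = 0) ->
    phi f <= theta) ->
  exists y : E, forall f, `|phi f - f y| <= theta * dual_norm f.
Proof.
move=> lphi t0 hphi.
have [phi0 phiN] := linear_form0N _ lphi.
have phiZ t f : phi (t *: f) = t * phi f.
  by have := lphi t f 0; rewrite !addr0 phi0 addr0.
pose K := [set k : dual E * R | (forall x, x \in xs -> k.1 x = 0) /\ k.2 = phi k.1].
have [|||||psi [lpsi psin psiK]] :=
  @mazur_orlicz R (dual E) (fun f => theta * dual_norm f) K.
- split=> [f g|t f t1].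
    by rewrite -mulrDr ler_pM2l //; exact: dual_norm_sublinear.1.
  by rewrite mulrCA ler_pM2l //; exact: dual_norm_sublinear.2.
- by split.
- move=> [f a] [g b] [/= hf ->] [/= hg ->]; split=> /= [x xxs|].
    by change (f x + g x = 0); rewrite hf // hg // addr0.
  by have := lphi 1 f g; rewrite !scale1r.
- move=> t [f a] _ [/= hf ->]; split=> /= [x xxs|]; last by rewrite phiZ.
  by change (t * f x = 0); rewrite hf // mulr0.
- move=> [f a] [/= hf ->]; have := dual_norm_ge0 f; rewrite le_eqVlt.
  case/predU1P => [n0|n0].
    rewrite -n0 mulr0; have -> : f = 0; last by rewrite phi0.
    apply/val_inj/funext => x; apply/eqP; rewrite -normr_le0.
    by have := dual_norm_eval f x; rewrite -n0 mul0r.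
  rewrite -ler_pdivrMr // mulrC -phiZ; apply: hphi => [|x xxs].
    have ni : 0 < (dual_norm f)^-1 by rewrite invr_gt0.
    apply: (le_trans (dual_norm_sublinear.2 _ _ ni)).
    by rewrite mulVf // gt_eqF.
  by change ((dual_norm f)^-1 * f x = 0); rewrite hf // mulr0.
have [_ psiN] := linear_form0N _ lpsi.
have [||y yE] := @functional_of_common_kernel _ _ xs (fun f => phi f - psi f).
- move=> a f g; rewrite lphi lpsi.
  change (a * phi f + phi g - (a * psi f + psi g) =
    a * (phi f - psi f) + (phi g - psi g)).
  by ring.
- move=> f hf; apply/eqP; rewrite subr_eq0 eq_le.
  rewrite (psiK (f, phi f)) //= -lerN2 -psiN -phiN.
  apply: (psiK (- f, phi (- f))); split=> //= x xxs.
  by change (- f x = 0); rewrite hf // oppr0.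
exists y => f; have := psin f; have := psin (- f).
by rewrite -yE subKr dual_normN psiN ler_norml lerNl => -> ->.
Qed.

(** Otherwise, for every [n], [phi] is within [1 / n.+1] of an evaluation at some
    [y n]; norming functionals turn this into a Cauchy estimate for [y], and
    [phi] is the evaluation at its limit. *)
Lemma helly_separation {R : realType} {E : completeNormedModType R}
    (phi : dual E -> R) :
  linear (phi : dual E -> R^o) ->
  ~ (exists y : E, forall f, phi f = f y) ->
  exists2 theta, 0 < theta & forall xs : seq E, exists f : dual E,
    [/\ dual_norm f <= 1, forall x, x \in xs -> f x = 0 & theta < phi f].
Proof.
move=> lphi nphi; apply: contrapT => nt; apply: nphi.
have /choice[y yP] (n : nat) : exists y : E, forall f : dual E,
    `|phi f - f y| <= n.+1%:R^-1 * dual_norm f.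
  have n0 : 0 < n.+1%:R^-1 :> R by rewrite invr_gt0 ltr0n.
  have [xs hxs] : exists xs : seq E, forall f : dual E, dual_norm f <= 1 ->
      (forall x, x \in xs -> f x = 0) -> phi f <= n.+1%:R^-1.
    apply: contrapT => nxs; apply: nt; exists n.+1%:R^-1 => // xs.
    apply: contrapT => nf; apply: nxs; exists xs => f f1 fxs.
    by rewrite leNgt; apply/negP => ltf; apply: nf; exists f.
  exact: functional_near_evaluation hxs.
have ydist m n : `|y m - y n| <= m.+1%:R^-1 + n.+1%:R^-1.
  have [f f1 <-] := norming_functional (y m - y n).
  have tri (u v w d1 d2 : R) : `|u - v| <= d1 -> `|u - w| <= d2 -> v - w <= d1 + d2.
    by rewrite !ler_norml => /andP[? ?] /andP[? ?]; lra.
  have hf k : `|phi f - f (y k)| <= k.+1%:R^-1.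
    by apply: le_trans (yP k f) _; rewrite ler_piMr // invr_ge0 ler0n.
  by rewrite linearB; apply: tri (hf m) (hf n).
have inv_cvg : (fun n : nat => n.+1%:R^-1 : R) @ \oo --> (0 : R) by exact: cvg_harmonic.
have inv_small e : 0 < e -> exists N, forall n, (N <= n)%N -> n.+1%:R^-1 < e :> R.
  move=> e0; have /cvgr0Pnorm_lt/(_ e e0)[N _ hN] := inv_cvg.
  exists N => n Nn; have := hN n Nn; rewrite /= ger0_norm // invr_ge0 ler0n.
have ycvg : cvg (y @ \oo).
  apply/cauchy_cvgP/cauchy_exP => e e0.
  have [|N hN] := inv_small (e / 2); first lra.
  exists (y N), N => // n /= Nn; rewrite -ball_normE /=.
  by apply: le_lt_trans (ydist _ _) _; rewrite [ltRHS]splitr; apply: ltrD; exact: hN.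
exists (lim (y @ \oo)) => f; apply/esym.
have fy : f (y n) @[n --> \oo] --> f (lim (y @ \oo)).
  by apply: (@continuous_cvg _ E R^o _ _ y (dual_fun f)) => //; exact: dual_fun_continuous.
have fphi : f (y n) @[n --> \oo] --> (phi f : R^o).
  apply/cvgrPdist_le => e e0.
  have n1 : 0 < dual_norm f + 1 by have := dual_norm_ge0 f; lra.
  have [|N hN] := inv_small (e / (dual_norm f + 1)); first by rewrite divr_gt0.
  exists N => // n /= Nn; apply: le_trans (yP n f) _.
  apply: (@le_trans _ _ (n.+1%:R^-1 * (dual_norm f + 1))).
    by rewrite ler_wpM2l ?invr_ge0 ?ler0n // lerDl.
  by rewrite -ler_pdivlMr //; exact/ltW/hN.
exact: (cvg_unique (@norm_hausdorff _ R^o) fy fphi).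
Qed.

(** * Weak closures and virtual points *)

Lemma filter_forall_seq {T : Type} {I : eqType} (F : set_system T) (s : seq I)
    (P : I -> set T) : Filter F ->
  (forall i, i \in s -> F (P i)) -> F [set x | forall i, i \in s -> P i x].
Proof.
move=> FF; elim: s => [|i s IH] hs; first by apply: filterS filterT => x _ i.
have Fi : F (P i) by apply: hs; rewrite inE eqxx.
have Fs : F [set x | forall j, j \in s -> P j x].
  by apply: IH => j js; apply: hs; rewrite inE js orbT.
apply: filterS2 Fi Fs => x Pix hx j.
by rewrite inE => /predU1P[->|/hx].
Qed.

Section WeakTopology.
Context {R : realType} {E : normedModType R}.
Implicit Types (f : dual E) (B : set E).

Lemma weak_eval_continuous f :
  continuous (fun x : weak_space E => (f : E -> R) (x : E)).
Proof.
move=> x; have /cvg_sup/(_ f) fx : nbhs (x : weak_space E) --> (x : weak_space E).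
  exact: cvg_id.
apply: cvg_trans.
  exact/cvg_app/fx.
exact: (@initial_continuous _ _ (dual_fun f)).
Qed.

Lemma weak_closure_approx B (z : E) (fs : seq (dual E)) (c : R) :
  @closure (weak_space E) B z -> (forall f, f \in fs -> c < f z) ->
  exists2 b, B b & forall f, f \in fs -> c < f b.
Proof.
move=> cBz fsz.
have : nbhs (z : weak_space E) [set x : weak_space E | forall f, f \in fs -> c < f x].
  apply: (@filter_forall_seq (weak_space E) _ _ fs (fun f x => c < f x)) => f ffs.
  apply: (@weak_eval_continuous f z [set r | c < r]).
  exact/lt_nbhsr/fsz.
by move=> /cBz[b [Bb hb]]; exists b.
Qed.

Lemma bounded_set_norm_le B :
  bounded_set B -> exists2 M, 0 < M & forall x, B x -> `|x| <= M.
Proof. by move=> /pinfty_ex_gt0[M M0 hM]; exists M. Qed.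

Lemma weak_closure_bound B (M : R) (z : E) f :
  (forall x, B x -> `|x| <= M) -> @closure (weak_space E) B z ->
  `|f z| <= dual_norm f * M.
Proof.
move=> BM cBz.
have h (g : dual E) : g z <= dual_norm g * M.
  rewrite leNgt; apply/negP => lt.
  have [|b Bb] := weak_closure_approx B z [:: g] (dual_norm g * M) cBz.
    by move=> g'; rewrite inE => /eqP ->; exact: lt.
  move=> /(_ g); rewrite inE eqxx ltNge => /(_ isT)/negP; apply.
  apply: le_trans (ler_norm _) _; apply: le_trans (dual_norm_eval _ _) _.
  by rewrite ler_wpM2l ?dual_norm_ge0 // BM.
rewrite ler_norml h andbT lerNl -(dual_normN f).
exact: (h (- f)).
Qed.

(** [phi] is the limit of the functionals along an ultrafilter on the weak closure
    of [B] that does not converge in it. Were [phi] the evaluation at [y], the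
    ultrafilter would converge weakly to [y], which would lie in the closure. *)
Lemma noncompact_virtual_point B : bounded_set B ->
  ~ weakly_relatively_compact B ->
  exists phi : dual E -> R, [/\ linear (phi : dual E -> R^o),
    ~ (exists y : E, forall f, phi f = f y) &
    forall (fs : seq (dual E)) (c : R), (forall f, f \in fs -> c < phi f) ->
      exists2 b, B b & forall f, f \in fs -> c < f b].
Proof.
move=> /bounded_set_norm_le[M _ BM] nB.
set K := @closure (weak_space E) B.
have [F [UF FK nF]] : exists F : set_system (weak_space E),
    [/\ UltraFilter F, F K & ~ exists2 z, K z & F --> z].
  apply: contrapT => hF; apply: nB.
  rewrite /weakly_relatively_compact compact_ultra => F UF FK.
  apply: contrapT => nF; apply: hF; exists F; split=> // -[z Kz Fz].
  by apply: nF; exists z.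
have PF : ProperFilter F by exact: ultra_proper.
have /choice[phi phiP] f : exists l : R, (f : E -> R) @ F --> l.
  have cpt := @segment_compact R (- (dual_norm f * M)) (dual_norm f * M).
  have [l [_ cl]] : `[- (dual_norm f * M), dual_norm f * M] `&`
      cluster ((f : E -> R) @ F) !=set0.
    apply: cpt.
    have sub : K `<=` f @^-1` `[- (dual_norm f * M), dual_norm f * M].
      move=> z Kz; rewrite /= in_itv /=.
      by have := weak_closure_bound B M z f BM Kz; rewrite ler_norml.
    exact: filterS sub FK.
  exists l => A Al; have [//|FnA] := in_ultra_setVsetC ((f : E -> R) @^-1` A) UF.
  by have [r [nAr Ar]] := cl (~` A) A FnA Al; case: (nAr Ar).
exists phi; split.
- move=> a f g; apply: (cvg_unique (@Rhausdorff R) (phiP _)).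
  have -> : (a *: f + g : E -> R) = (fun x => a * f x + g x) by [].
  by apply: cvgD; [apply: cvgMl_tmp; exact: phiP|exact: phiP].
- move=> [y phiy]; apply: nF.
  have Fy : F --> (y : weak_space E).
    apply/cvg_sup => f U [_ [[W oW <-] Wy] /filterS]; apply.
    by apply: phiP; rewrite phiy; exact: open_nbhs_nbhs.
  exists y => //; apply: (@closed_closure (weak_space E) B) => U /Fy FU.
  exact: filter_ex (filterI FK FU).
- move=> fs c fsc.
  have Ffs : F [set x | forall f, f \in fs -> c < f x].
    apply: (@filter_forall_seq (weak_space E) _ _ fs (fun f x => c < f x)) => f ffs.
    apply: (phiP f [set r | c < r]); exact/lt_nbhsr/fsc.
  have [z [Kz hz]] := filter_ex (filterI FK Ffs).
  exact: (weak_closure_approx B z fs c Kz hz).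
Qed.

End WeakTopology.

(** * James' array and its convex blocks *)

(** Each index below [N] belongs to at most one block. *)
Lemma disjoint_blocks_escape (A : nat -> {fset nat}) (N : nat) :
  (forall m n, m != n -> [disjoint A m & A n]%fset) ->
  exists J, forall j, (J <= j)%N -> forall k, k \in A j -> (N <= k)%N.
Proof.
move=> dA; elim: N => [|N [J hJ]]; first by exists 0%N.
have [[j0 Nj0]|nN] := pselect (exists j0, N \in A j0).
  exists (maxn J j0.+1) => j; rewrite geq_max => /andP[Jj j0j] k kj.
  rewrite ltn_neqAle (hJ j) // andbT; apply/eqP => Nk.
  have /dA/fdisjointP/(_ N Nj0) : j0 != j by rewrite ltn_eqF.
  by rewrite Nk kj.
exists J => j Jj k kj; rewrite ltn_neqAle (hJ j) // andbT; apply/eqP => Nk.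
by apply: nN; exists j; rewrite Nk.
Qed.

(** [f n] is chosen by separation from the points found before it, hence the zeros
    below the diagonal; [x n] is a point of [B] that approximates [phi] on
    [f 0, ..., f n], hence the bounds on and above the diagonal. *)
Lemma james_sequences {R : realType} {E : completeNormedModType R} (B : set E) :
  bounded_set B -> ~ weakly_relatively_compact B ->
  exists (theta : R) (f : nat -> dual E) (x : nat -> E), [/\ 0 < theta,
    forall n, dual_norm (f n) <= 1, forall k, B (x k),
    forall n k, (n <= k)%N -> theta < f n (x k) &
    forall n k, (k < n)%N -> f n (x k) = 0].
Proof.
move=> bB nB; have [phi [lphi nphi approx]] := noncompact_virtual_point B bB nB.
have [theta t0 /choice[hf hfP]] := helly_separation phi lphi nphi.
have /choice[hb hbP] (fs : seq (dual E)) : exists b,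
    (forall f, f \in fs -> theta < phi f) ->
    B b /\ forall f, f \in fs -> theta < f b.
  have [h|nh] := pselect (forall f, f \in fs -> theta < phi f).
    by have [b Bb hb] := approx fs theta h; exists b.
  by exists 0.
pose next (s : seq E * seq (dual E)) :=
  (hb (hf s.1 :: s.2) :: s.1, hf s.1 :: s.2).
pose st n := iter n next ([::], [::]).
pose f n := hf (st n).1; pose x n := hb (f n :: (st n).2).
have xsS n : (st n.+1).1 = x n :: (st n).1 by [].
have fsS n : (st n.+1).2 = f n :: (st n).2 by [].
have xst n k : (k < n)%N -> x k \in (st n).1.
  elim: n => // n IH; rewrite ltnS leq_eqVlt => /predU1P[->|/IH h].
    by rewrite xsS inE eqxx.
  by rewrite xsS inE h orbT.
have fst n k : (k < n)%N -> f k \in (st n).2.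
  elim: n => // n IH; rewrite ltnS leq_eqVlt => /predU1P[->|/IH h].
    by rewrite fsS inE eqxx.
  by rewrite fsS inE h orbT.
have stphi n g : g \in (st n).2 -> theta < phi g.
  elim: n => // n IH; rewrite fsS inE => /predU1P[->|/IH //].
  by have [] := hfP (st n).1.
have xP n := hbP (st n.+1).2 (stphi n.+1).
exists theta, f, x; split=> // [n|k|n k nk|n k kn].
- by have [] := hfP (st n).1.
- by have [] := xP k.
- by have [_] := xP k; apply; exact: fst.
- by have [_ + _] := hfP (st n).1; apply; exact: xst.
Qed.

Lemma sum_dualE {R : realType} {E : normedModType R} (A : seq nat)
    (lambda : nat -> R) (f : nat -> dual E) (x : E) :
  (\sum_(k <- A) lambda k *: f k) x = \sum_(k <- A) lambda k * (f k x : R) :> R.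
Proof.
elim: A => [|k A IH]; first by rewrite !big_nil.
by rewrite !big_cons -IH.
Qed.

(** [h j] is the [j]-th block minus the weak-star limit [l] of the blocks. Since the
    blocks escape to infinity, their values at [x k] are eventually averages of
    zeros, so [l (x k) <= 0]; and a fixed block is an average of values above
    [theta] at [x k] as soon as [k] is beyond its last index. *)
Lemma james_null_sequence {R : realType} {E : completeNormedModType R}
    (B : set E) :
  convex_block_compact (dual_unit_ball E : set (weak_star_dual E)) ->
  bounded_set B -> ~ weakly_relatively_compact B ->
  exists (theta : R) (h : nat -> dual E) (x : nat -> E), [/\ 0 < theta,
    forall k, B (x k),
    forall j y, `|h j y| <= 2 * `|y|,
    forall y, h j y @[j --> \oo] --> (0 : R) &
    forall j, exists K, forall k, (K <= k)%N -> theta <= h j (x k)].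
Proof.
move=> hE bB nB.
have [theta [f [x [t0 f1 Bx flo fup]]]] := james_sequences B bB nB.
have [y [A [lambda [dA l0 yE l1]]] [l lball yl]] :=
  hE (f : nat -> weak_star_dual E) f1.
have yv j z : (y j : dual E) z = \sum_(k <- A j) lambda k * (f k z : R) :> R.
  by rewrite yE; exact: sum_dualE.
have yl_eval z : (y j : dual E) z @[j --> \oo] --> ((l : dual E) z : R).
  apply: (@continuous_cvg _ (weak_star_dual E) R^o _ _ y
    (fun f : weak_star_dual E => (f : dual E) z)) => //.
  exact: weak_star_eval_continuous.
have ball_eval (g : dual E) z : dual_norm g <= 1 -> `|g z| <= `|z|.
  by move=> g1; apply: le_trans (dual_norm_eval g z) _; rewrite ler_piMl.
have l_le0 k : (l : dual E) (x k) <= (0 : R).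
  apply: (ler_cvg_to (yl_eval (x k)) (cvg_cst 0)).
  have [J hJ] := disjoint_blocks_escape A k.+1 dA.
  exists J => // j /= Jj; rewrite yv big1_seq // => i /andP[_ iA].
  by rewrite fup ?mulr0 //; exact: hJ iA.
exists theta, (fun j => (y j : dual E) - (l : dual E)), x; split=> //.
- move=> j z; change (`|(y j : dual E) z - (l : dual E) z| <= 2 * `|z|).
  have -> : 2 * `|z| = `|z| + `|z| by rewrite mulr_natl mulr2n.
  apply: le_trans (ler_normB _ _) _; apply: lerD; last exact: ball_eval.
  have -> : `|z| = \sum_(k <- A j) lambda k * `|z| by rewrite -mulr_suml l1 mul1r.
  rewrite yv; apply: le_trans (ler_norm_sum _ _ _) _; apply: ler_sum => k _.
  by rewrite normrM ger0_norm // ler_wpM2l // ball_eval.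
- move=> z; rewrite -(subrr ((l : dual E) z : R)).
  by apply: cvgB; [exact: yl_eval|exact: cvg_cst].
move=> j; exists (\max_(k <- A j) k) => k kA.
change (theta <= ((y j : dual E) (x k) : R) - (l : dual E) (x k)).
rewrite lerBrDr; apply: (@le_trans _ _ theta).
  by rewrite gerDl.
have -> : theta = \sum_(k <- A j) lambda k * theta by rewrite -mulr_suml l1 mul1r.
rewrite yv big_seq [leRHS]big_seq; apply: ler_sum => i iA.
rewrite ler_wpM2l //; apply/ltW/flo; apply: leq_trans kA.
exact: leq_bigmax_seq.
Qed.

(** * Classes of tail combinations *)

Lemma dual_dyadic_sum {R : realType} {E : normedModType R} (g : nat -> dual E)
    (M : R) :
  (forall i x, `|g i x| <= M * `|x|) ->
  exists G : dual E, forall x,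
    series (fun i => 2^-1 ^+ i.+1 * (g i x : R)) @ \oo --> (G x : R).
Proof.
move=> gM.
pose h x : R := limn (series (fun i => 2^-1 ^+ i.+1 * (g i x : R))).
have hP x : series (fun i => 2^-1 ^+ i.+1 * (g i x : R)) @ \oo --> h x.
  exact: dyadic_series_is_cvg (fun i => gM i x).
have hM x : `|h x| <= M * `|x|.
  rewrite ler_norml; apply/andP; split.
    by apply: dyadic_series_ge (hP x) => i; have := gM i x; rewrite ler_norml => /andP[].
  by apply: dyadic_series_le (hP x) => i; have := gM i x; rewrite ler_norml => /andP[].
have lh : linear (h : E -> R^o).
  move=> a x y; apply: (cvg_unique (@Rhausdorff R) (hP _)).
  have -> : series (fun i => 2^-1 ^+ i.+1 * (g i (a *: x + y) : R)) =
      (fun n => a * series (fun i => 2^-1 ^+ i.+1 * (g i x : R)) n +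
        series (fun i => 2^-1 ^+ i.+1 * (g i y : R)) n).
    apply/funext => n; rewrite /series /= big_distrr -big_split /=.
    apply: eq_bigr => i _; rewrite linearP mulrDr; congr (_ + _).
    exact: mulrCA.
  by apply: cvgD; [apply: cvgMl_tmp; exact: hP|exact: hP].
have [G Gh] := dual_of_bounded _ _ lh hM.
by exists G => x; rewrite Gh; exact: hP.
Qed.

(** This class contains the countable convex combinations of [h n, h n.+1, ...] that
    matter: the first condition says that [F] is pointwise at most the supremum of
    that tail, the second one that the lower limit of [F] along [x] is at least
    [theta]. Both pass to dyadic combinations without any reference to
    coefficients. *)
Definition tail_class {R : realType} {E : normedModType R} (h : nat -> dual E)
    (x : nat -> E) (theta : R) (n : nat) : set (dual E) :=
  [set F | (forall y (a : R), (forall k, (n <= k)%N -> h k y <= a) -> F y <= a) /\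
           forall eta : R, 0 < eta ->
             exists K, forall k, (K <= k)%N -> theta - eta <= F (x k)].

Lemma tail_class_dyadic {R : realType} {E : normedModType R} (h : nat -> dual E)
    (x : nat -> E) (theta M : R) (n : nat) (g : nat -> dual E) :
  (forall j y, `|h j y| <= 2 * `|y|) -> (forall k, `|x k| <= M) ->
  (forall i, tail_class h x theta n (g i)) ->
  exists2 G, tail_class h x theta n G & forall y,
    series (fun i => 2^-1 ^+ i.+1 * (g i y : R)) @ \oo --> (G y : R).
Proof.
move=> hb xM gC.
have gb i y : `|g i y| <= 2 * `|y|.
  have gle z : (g i z : R) <= 2 * `|z|.
    by apply: (gC i).1 => k _; apply: le_trans (ler_norm _) (hb k z).
  rewrite ler_norml gle andbT lerNl -normrN.
  by apply: le_trans (gle (- y)); rewrite linearN.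
have [G GE] := dual_dyadic_sum g 2 gb.
exists G => //; split=> [y a hya|eta eta0].
  by apply: dyadic_series_le (GE y) => i; exact: (gC i).1.
have M0 : 0 <= M by exact: le_trans (normr_ge0 _) (xM 0%N).
(* [W] bounds the loss when the [N]-tail of the dyadic weights is estimated by
   [- 2 M] rather than by [theta - eta / 2]. *)
pose W := `|theta| + 2 * M + 1.
have W0 : 0 < W by rewrite /W; have := normr_ge0 theta; lra.
have [N hN] : exists N, 2^-1 ^+ N * W <= eta / 2.
  have : (fun N => 2^-1 ^+ N : R) @ \oo --> (0 : R).
    by apply: cvg_expr; rewrite ger0_norm; lra.
  move=> /cvgr0Pnorm_le/(_ (eta / 2 / W)) [|N _ hN].
    by rewrite !divr_gt0.
  exists N; rewrite -ler_pdivlMr //; apply: le_trans (hN N (leqnn N)).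
  exact: ler_norm.
have [K hK] : exists K, forall i, (i < N)%N -> forall k, (K <= k)%N ->
    theta - eta / 2 <= g i (x k).
  elim: (N) => [|m [K hK]]; first by exists 0%N.
  have [|K' hK'] := (gC m).2 (eta / 2); first lra.
  exists (maxn K K') => i; rewrite ltnS leq_eqVlt => im k; rewrite geq_max.
  move=> /andP[Kk K'k]; case/predU1P: im => [->|im]; first exact: hK'.
  exact: hK.
exists K => k Kk.
have glo i : - (2 * M) <= g i (x k) :> R.
  have := gb i (x k); rewrite ler_norml => /andP[+ _].
  by apply: le_trans; rewrite lerN2 ler_pM2l.
apply: le_trans (dyadic_series_ge_head N _ _ _ _ (fun i iN => hK i iN k Kk) glo (GE (x k))).
have e0 : 0 <= 2^-1 ^+ N :> R by apply: exprn_ge0; lra.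
have := ler_norm theta; move: hN e0; rewrite /W; move: (2^-1 ^+ N) => e; nra.
Qed.

(** Simons' inequality on the weak closure of [D], where compactness provides the
    maxima and the pointwise upper limit is [0]. *)
Lemma tail_class_small {R : realType} {E : normedModType R} (h : nat -> dual E)
    (x : nat -> E) (theta M : R) (D : set E) (eps : R) (n : nat) :
  (forall j y, `|h j y| <= 2 * `|y|) -> (forall k, `|x k| <= M) ->
  (forall y, h j y @[j --> \oo] --> (0 : R)) ->
  (forall j, exists K, forall k, (K <= k)%N -> theta <= h j (x k)) ->
  weakly_relatively_compact D -> 0 < eps ->
  exists2 F, tail_class h x theta n F & forall d, D d -> F d <= eps.
Proof.
move=> hb xM h0 hx cD eps0.
have hC m : tail_class h x theta m (h m).
  split=> [y a|eta eta0]; first by apply.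
  by have [K hK] := hx m; exists K => k /hK; apply: le_trans; lra.
have [D0|/set0P[d0 Dd0]] := eqVneq D set0.
  by exists (h n) => // d; rewrite D0.
have subD d : D d -> @closure (weak_space E) D d by exact: subset_closure.
have [|||||F FC Fle] := simons_inequality (fun (F : dual E) (y : E) => (F y : R))
  (@closure (weak_space E) D) (fun m => tail_class h x theta (n + m)) 0 eps eps0.
- by move=> m; exists (h (n + m)%N).
- move=> m F [F1 F2]; split=> // y a hya; apply: F1 => k nk.
  by apply: hya; apply: leq_trans nk; rewrite addnS.
- move=> m g gC; have [G GC GE] := tail_class_dyadic h x theta M _ g hb xM gC.
  by exists G.
- move=> F _; have [||c cD' cmax] := @compact_EVT_max (weak_space E) R
    (fun y : weak_space E => (F : E -> R) (y : E)) (@closure (weak_space E) D) _ cD.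
  + by exists d0; exact: subD.
  + by apply: continuous_subspaceT; exact: weak_eval_continuous.
  exists c; first by rewrite inE in cD'.
  by move=> y Dy; apply: cmax; rewrite inE.
- move=> y eta _ eta0; have /cvgr0Pnorm_le/(_ eta eta0)[N _ hN] := h0 y.
  exists N => F [F1 _]; rewrite add0r; apply: F1 => k nk.
  apply: le_trans (ler_norm _) (hN k _); exact: leq_trans (leq_addl _ _) nk.
exists F => [|d Dd]; first by rewrite addn0 in FC.
by have := Fle d (subD d Dd); rewrite add0r.
Qed.

(** * The compactness theorem *)

Lemma attains_sup_max {R : realType} {E : normedModType R} (f : dual E)
    (B : set E) :
  attains_sup f B -> exists2 b, B b & forall x, B x -> f x <= f b.
Proof.
move=> [b Bb fb]; exists b => // x Bx.
by rewrite -lee_fin fb; apply: ereal_sup_ubound; exists x.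
Qed.

(** For nonempty [D], [e] is a small multiple of a point of [L_ D], and [eps] is half
    of what its supremum on [D] lies below [0]. For empty [D] the only condition is
    [F + e != 0], and [e = 0] will do. *)
Lemma L_perturbation {R : realType} {E : normedModType R} (D : set E) (delta : R) :
  L_ D !=set0 -> 0 < delta ->
  exists (e : dual E) (eps : R), [/\ 0 < eps, dual_norm e <= delta &
    forall F : dual E, F + e != 0 -> (forall d, D d -> F d <= eps) -> L_ D (F + e)].
Proof.
move=> [e0 De0] delta0.
have [D0|Dn0] := eqVneq D set0.
  exists 0, 1; split=> //; last by move=> F Fe _; rewrite /L_ D0 eqxx.
  apply: dual_norm_le => [|y]; first exact: ltW.
  by change (`|0 : R| <= delta * `|y|); rewrite normr0 mulr_ge0 // ltW.
have [alpha a0 ha] : exists2 alpha, 0 < alpha & forall d, D d -> e0 d <= - alpha.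
  move: De0; rewrite /L_ (negPf Dn0) /= => lt0.
  have /set0P[d Dd] := Dn0.
  have ub y : D y -> ((e0 y)%:E <= ereal_sup [set (e0 d)%:E | d in D])%E.
    by move=> Dy; apply: ereal_sup_ubound; exists y.
  move: lt0 ub; case: (ereal_sup _) => [r| |] //.
    rewrite lte_fin => r0 ub; exists (- r); first lra.
    by move=> y /ub; rewrite lee_fin opprK.
  by move=> _ /(_ d Dd).
pose t := delta / (dual_norm e0 + 1).
have t0 : 0 < t by rewrite divr_gt0 //; have := dual_norm_ge0 e0; lra.
exists (t *: e0), (t * alpha / 2); split.
- by rewrite divr_gt0 // mulr_gt0.
- apply: le_trans (dual_norm_sublinear.2 _ _ t0) _; rewrite /t mulrAC.
  by rewrite ler_pdivrMr ?ler_pM2l ?lerDl //; have := dual_norm_ge0 e0; lra.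
move=> F _ FD; rewrite /L_ (negPf Dn0) /=.
apply: (@le_lt_trans _ _ (- (t * alpha / 2))%:E); last first.
  by rewrite lte_fin oppr_lt0 divr_gt0 // mulr_gt0.
apply: ge_ereal_sup => _ [d Dd <-]; rewrite lee_fin.
change ((F d : R) + t * e0 d <= - (t * alpha / 2)).
have half (u v w : R) : u <= w / 2 -> v <= - w -> u + v <= - (w / 2) by lra.
by apply: half; [exact: FD|rewrite -mulrN ler_pM2l // ha].
Qed.

Theorem theorem10 (R : realType) (E : completeNormedModType R) (D B : set E)
  (hE : @convex_block_compact R (weak_star_dual E) (dual_unit_ball E))
  (hD : weakly_relatively_compact D)
  (hL : L_ D !=set0)
  (hB : bounded_set B)
  (hsup : forall f : dual E, L_ D f -> attains_sup f B) :
  weakly_relatively_compact B.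
Proof.
apply: contrapT => nB.
have [theta [h [x [t0 Bx hb h0 hx]]]] := james_null_sequence B hE hB nB.
have [M M0 BM] := bounded_set_norm_le B hB.
have xM k := BM _ (Bx k).
have delta0 : 0 < theta / 4 / M by rewrite !divr_gt0.
have [e [eps [eps0 en eL]]] := L_perturbation D _ hL delta0.
have eB b : B b -> `|e b| <= theta / 4.
  move=> Bb; apply: le_trans (dual_norm_eval e b) _.
  rewrite -[leRHS](@divfK _ M) ?gt_eqF //; apply: ler_pM => //; last exact: BM.
  exact: dual_norm_ge0.
pose C n := [set F | tail_class h x theta n F /\ forall d, D d -> F d <= eps].
(* The choice of [theta / 4] and [theta / 8] below leaves a gap between the upper
   bound [3 / 8 * theta] on [B] and this lower bound [theta / 2]. *)
have large F n : C n F -> exists2 b, B b & theta / 2 <= F b + e b.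
  move=> [[_ FK] _]; have [|K hK] := FK (theta / 4); first lra.
  exists (x K) => //; have := hK _ (leqnn K); have := eB _ (Bx K).
  by rewrite ler_norml => /andP[]; move: (e (x K) : R) (F (x K) : R) => u v; lra.
have [||||||F FC Fle] := simons_inequality
  (fun (F : dual E) (y : E) => (F y : R) + e y) B C (theta / 4) (theta / 8).
- lra.
- move=> n; have [F FC FD] := tail_class_small h x theta M D eps n hb xM h0 hx hD eps0.
  by exists F.
- move=> n F [[F1 F2] FD]; split=> //; split=> // y a hya; apply: F1 => k nk.
  by apply: hya; exact: ltnW.
- move=> n g gC.
  have [G GC GE] := tail_class_dyadic h x theta M n g hb xM (fun i => (gC i).1).
  exists G => [|y _].
    by split=> // d Dd; apply: dyadic_series_le (GE d) => i; exact: (gC i).2.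
  have -> : series (fun i => 2^-1 ^+ i.+1 * ((g i y : R) + e y)) =
      (fun n => series (fun i => 2^-1 ^+ i.+1 * (g i y : R)) n +
        series (fun i => 2^-1 ^+ i.+1 * (e y : R)) n).
    apply/funext => m; rewrite /series /= -big_split /=.
    by apply: eq_bigr => i _; rewrite mulrDr.
  by apply: cvgD; [exact: GE|exact: dyadic_series_cst].
- move=> F FC; apply: (@attains_sup_max _ _ (F + e)); apply/hsup/eL; last exact: FC.2.
  apply/eqP => Fe0; have [b _] := large F _ FC.
  have -> : (F b : R) + e b = 0 by have := congr1 (fun f : dual E => f b : R) Fe0.
  lra.
- move=> y eta By eta0; have /cvgr0Pnorm_le/(_ eta eta0)[N _ hN] := h0 y.
  exists N => F [[F1 _] _]; rewrite addrC; apply: lerD.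
    by apply: le_trans (ler_norm _) (eB _ By).
  by apply: F1 => k nk; apply: le_trans (ler_norm _) (hN k nk).
have [b Bb] := large F _ FC; have := Fle b Bb; lra.
Qed.
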